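(* Let $\varphi$ be a finite conjunction of literals of the two forms $x\in y$ and $x = y\setminus z$ (with $x,y,z$ set variables), with finite set of variables $\mathrm{Vars}(\varphi)$, and let $\bar n=|\mathrm{Vars}(\varphi)|$. Let $M$ be a set assignment over $\mathrm{Vars}(\varphi)$ satisfying $\varphi$; let $\bar x,\bar y\in\mathrm{Vars}(\varphi)$, let $\overline{M}$ be a set assignment over $\mathrm{Vars}(\varphi)$ satisfying $\varphi$ with $\overline{M}\bar x\neq \overline{M}\bar y$, and let $\mathfrak{t}$ be a set belonging to exactly one of $\overline{M}\bar x$, $\overline{M}\bar y$. Fix a set $\mathfrak{s}$ with $\mathrm{rk}(\mathfrak{s})>\mathrm{rk}(M)$. Define $\mathsf{V}_0=\{u\in\mathrm{Vars}(\varphi)\mid \mathfrak{t}\in\overline{M}u\}$; $\mathsf{V}_n=\{u\in\mathrm{Vars}(\varphi)\mid Mu\cap\{Mw\mid w\in\mathsf{V}_{n-1}\}\neq\emptyset\}$ for $n\ge1$; $M_0v=Mv\cup\{\mathfrak{s}\}$ if $v\in\mathsf{V}_0$ and $M_0v=Mv$ otherwise; for $n\ge1$, $M_nv=M_{n-1}v\cup\{M_{n-1}u\mid u\in\mathsf{V}_{n-1},\ Mu\in Mv\}$ if $v\in\mathsf{V}_n$ and $M_nv=M_{n-1}v$ otherwise. Then the set assignment $M_{\bar n}$ satisfies $\varphi$.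
   Context: A set assignment is a map from a finite set of set variables into the von Neumann universe $\mathcal{V}=\bigcup_\alpha\mathcal{V}_\alpha$, $\mathcal{V}_\alpha=\bigcup_{\beta<\alpha}\mathcal{P}(\mathcal{V}_\beta)$; it satisfies $x\in y$ iff $Mx\in My$ and $x=y\setminus z$ iff $Mx=My\setminus Mz$, and satisfies a conjunction iff it satisfies each conjunct. The rank $\mathrm{rk}(s)$ of a set $s$ is the least ordinal $\alpha$ with $s\subseteq\mathcal{V}_\alpha$, and $\mathrm{rk}(M)=\max\{\mathrm{rk}(Mx)\mid x\in\mathrm{dom}(M)\}$. *)

(* Defs.v *)
(* Stdlib + mathcomp boot world.  The von Neumann universe is modelled by
   Aczel's type-theoretic sets (well-founded trees with extensional equality). *)
From mathcomp Require Import all_boot.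
From Stdlib Require Import ClassicalDescription.

Set Implicit Arguments.
Unset Strict Implicit.
Unset Printing Implicit Defensive.

Inductive Vset : Type := sup (A : Type) (f : A -> Vset).

Fixpoint eqV (x y : Vset) : Prop :=
  match x, y with
  | sup A f, sup B g =>
      (forall a, exists b, eqV (f a) (g b)) /\ (forall b, exists a, eqV (f a) (g b))
  end.

Definition memV (x y : Vset) : Prop :=
  match y with sup B g => exists b, eqV x (g b) end.

Definition union2 (x y : Vset) : Vset :=
  match x, y with
  | sup A f, sup B g =>
      sup (fun c : A + B => match c with inl a => f a | inr b => g b end)
  end.

Definition single (x : Vset) : Vset := sup (fun _ : unit => x).

Definition setdiff (y z : Vset) : Vset :=
  match y with
  | sup B g => sup (fun b : {b : B | ~ memV (g b) z} => g (proj1_sig b))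
  end.

(* ---------- ranks ----------
   rk_le x y  <->  rk(x) <= rk(y);   rk_lt x y  <->  rk(x) < rk(y).
   Since rk(y) = sup { rk(b)+1 | b in y }, we have
   rk x < rk y  iff  exists b in y, rk x <= rk b, and
   rk x <= rk y iff  forall a in x, rk a < rk y. *)
Fixpoint rk_le (x y : Vset) : Prop :=
  match x with
  | sup A f => forall a, match y with sup B g => exists b, rk_le (f a) (g b) end
  end.

Definition rk_lt (x y : Vset) : Prop :=
  match y with sup B g => exists b, rk_le x (g b) end.

Inductive lit : Type :=
| LMem (x y : nat)
| LDiff (x y z : nat).

Definition lit_vars (l : lit) : seq nat :=
  match l with LMem x y => [:: x; y] | LDiff x y z => [:: x; y; z] end.

Definition formula := seq lit.

Definition Vars (phi : formula) : seq nat := undup (flatten (map lit_vars phi)).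

Definition assignment := nat -> Vset.

Definition sat_lit (M : assignment) (l : lit) : Prop :=
  match l with
  | LMem x y => memV (M x) (M y)
  | LDiff x y z => eqV (M x) (setdiff (M y) (M z))
  end.

Definition satisfies (M : assignment) (phi : formula) : Prop :=
  forall l, List.In l phi -> sat_lit M l.

(* rk(M) < rk(s), with rk(M) = max over Vars(phi) of rk(M u) *)
Definition rank_assign_lt (phi : formula) (M : assignment) (s : Vset) : Prop :=
  forall u, u \in Vars phi -> rk_lt (M u) s.

Section Construction.
Variables (phi : formula) (M Mbar : assignment) (t s : Vset).

Fixpoint VV (n : nat) (u : nat) : Prop :=
  u \in Vars phi /\
  match n with
  | 0 => memV t (Mbar u)
  | n'.+1 => exists w, VV n' w /\ memV (M w) (M u)
  end.

Fixpoint MM (n : nat) : assignment :=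
  match n with
  | 0 => fun v =>
      if excluded_middle_informative (VV 0 v) then union2 (M v) (single s) else M v
  | n'.+1 => fun v =>
      if excluded_middle_informative (VV n'.+1 v) then
        union2 (MM n' v)
               (sup (fun u : {u : nat | VV n' u /\ memV (M u) (M v)} => MM n' (proj1_sig u)))
      else MM n' v
  end.

End Construction.

(* Main.v *)
(* Every element of M u, for u a variable, has rank below rk(s), while every
   element the construction adds has rank at least rk(s): it is s itself or
   some M_j u with u in V_j, and s lies in the transitive closure of M_j u.
   So M_n v is the disjoint union of its old part M v and its new part, and
   rank tells them apart; in particular M_j u = M_j' u' forces M u = M u'.
   A literal x = y \ z holds in M_n because it holds on the old parts (by M)
   and on the new parts: the members added at stage 0 are governed by
   t \in Mbar u, and Mbar satisfies the literal; those added later by the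
   membership M u \in M v, and M satisfies it.
   For a literal x \in y, by induction either x \in V_n or M_n x \in M_n y:
   once x enters V_n, y enters V_(n+1) and M_(n+1) y receives M_n x.  A
   variable in V_n ends an \in-chain of n+1 distinct variables, so
   V_|Vars phi| is empty. *)
Require Import Defs.
From mathcomp Require Import all_boot.
From Stdlib Require Import ClassicalDescription Setoid.

Set Implicit Arguments.
Unset Strict Implicit.
Unset Printing Implicit Defensive.

Lemma eqV_refl x : eqV x x.
Proof. by elim: x => A f IH /=; split=> a; exists a. Qed.

Lemma eqV_sym x y : eqV x y -> eqV y x.
Proof.
elim: x y => A f IH [B g] /= [fg gf]; split.
- by move=> b; have [a /IH] := gf b; exists a.
- by move=> a; have [b /IH] := fg a; exists b.
Qed.

Lemma eqV_trans x y z : eqV x y -> eqV y z -> eqV x z.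
Proof.
elim: x y z => A f IH [B g] [C h] /= [fg gf] [gh hg]; split.
- move=> a; have [b fgb] := fg a; have [c gbh] := gh b.
  by exists c; exact: IH fgb gbh.
- move=> c; have [b gbh] := hg c; have [a fgb] := gf b.
  by exists a; exact: IH fgb gbh.
Qed.

Lemma memV_eqVl a a' b : eqV a a' -> memV a b -> memV a' b.
Proof.
by case: b => B g /= aa' [b ab]; exists b; apply: eqV_trans (eqV_sym aa') ab.
Qed.

Lemma memV_eqVr a b b' : eqV b b' -> memV a b -> memV a b'.
Proof.
case: b b' => B g [C h] /= [gh _] [b ab]; have [c gbh] := gh b.
by exists c; exact: eqV_trans ab gbh.
Qed.

Lemma eqV_ext a b : (forall e, memV e a <-> memV e b) -> eqV a b.
Proof.
case: a b => A f [B g] /= ab; split.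
- by move=> a; apply/ab; exists a; exact: eqV_refl.
- move=> b; have [a fa] : memV (g b) (sup f) by apply/ab; exists b; exact: eqV_refl.
  by exists a; exact: eqV_sym.
Qed.

Lemma memV_union2 e a b : memV e (union2 a b) <-> memV e a \/ memV e b.
Proof.
case: a b => A f [B g] /=; split.
- by case=> -[a|b] ?; [left; exists a | right; exists b].
- by case=> -[x ?]; [exists (inl x) | exists (inr x)].
Qed.

Lemma memV_single e x : memV e (single x) <-> eqV e x.
Proof. by split; [case | exists tt]. Qed.

Lemma memV_setdiff e a b : memV e (setdiff a b) <-> memV e a /\ ~ memV e b.
Proof.
case: a => I g /=; split.
- case=> -[i ni] /= ei; split; first by exists i.
  by move=> /(memV_eqVl ei).
- case=> -[i ei] ne.
  have ni : ~ memV (g i) b by move=> /(memV_eqVl (eqV_sym ei)).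
  by exists (exist _ i ni).
Qed.

Lemma memV_eqV_setdiff e a b c : eqV a (setdiff b c) ->
  memV e a <-> memV e b /\ ~ memV e c.
Proof.
move=> abc; rewrite -memV_setdiff.
by split; apply: memV_eqVr; [| apply: eqV_sym].
Qed.

Lemma eqV_rk_le x y : eqV x y -> rk_le x y.
Proof. by elim: x y => A f IH [B g] /= [fg _] a; have [b /IH] := fg a; exists b. Qed.

Lemma rk_le_trans x y z : rk_le x y -> rk_le y z -> rk_le x z.
Proof.
elim: x y z => A f IH [B g] [C h] /= fg gh a.
have [b fgb] := fg a; have [c gbh] := gh b.
by exists c; exact: IH fgb gbh.
Qed.

Lemma rk_lt_le x y : rk_lt x y -> rk_le x y.
Proof.
elim: x y => A f IH [B g] [b fgb] a; exists b; apply: IH.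
by move: fgb; case: (g b) => C h /=; apply.
Qed.

Lemma rk_le_lt_trans x y z : rk_le x y -> rk_lt y z -> rk_lt x z.
Proof. by case: z => C h /= xy [c yh]; exists c; exact: rk_le_trans xy yh. Qed.

Lemma rk_lt_trans x y z : rk_lt x y -> rk_lt y z -> rk_lt x z.
Proof. by move/rk_lt_le; apply: rk_le_lt_trans. Qed.

Lemma rk_lt_irr x : ~ rk_lt x x.
Proof. by elim: x => A f IH /= [a fa]; apply: (IH a); exact: fa a. Qed.

Lemma rk_le_lt_asym x y : rk_le x y -> rk_lt y x -> False.
Proof. by move=> xy /(rk_le_lt_trans xy); apply: rk_lt_irr. Qed.

Lemma memV_rk_lt a b : memV a b -> rk_lt a b.
Proof. by case: b => B g /= [b /eqV_rk_le]; exists b. Qed.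

Lemma lit_vars_Vars phi l x : List.In l phi -> x \in lit_vars l -> x \in Vars phi.
Proof.
rewrite /Vars mem_undup; elim: phi => //= l' phi IH [<-|l_phi] x_l.
  by rewrite mem_cat x_l.
by rewrite mem_cat IH ?orbT.
Qed.

Section Construction.
Variables (phi : formula) (M Mbar : assignment) (t s : Vset).
Notation V := (VV phi M Mbar t).
Notation MMn := (MM phi M Mbar t s).

Lemma VV_Vars n u : V n u -> u \in Vars phi.
Proof. by case: n => [|n] []. Qed.

Lemma VV_chain n u : V n u -> exists ws : seq nat,
  [/\ uniq (u :: ws), size ws = n, {subset u :: ws <= Vars phi} &
      forall w, w \in ws -> rk_lt (M w) (M u)].
Proof.
elim: n u => [|n IH] u /=.
  by case=> u_phi _; exists [::]; split=> // w; rewrite inE => /eqP ->.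
case=> u_phi [w [Vw wu]]; have [ws [uniq_ws <- ws_phi ws_w]] := IH w Vw.
have below_u w' : w' \in w :: ws -> rk_lt (M w') (M u).
  rewrite inE => /predU1P [->|w'_ws]; first exact: memV_rk_lt.
  exact: rk_lt_trans (ws_w w' w'_ws) (memV_rk_lt wu).
exists (w :: ws); split=> //.
- by apply/andP; split=> //; apply/negP => /below_u /rk_lt_irr.
- by move=> x; rewrite inE => /predU1P [->|/ws_phi].
Qed.

Lemma VV_size_Vars u : ~ V (size (Vars phi)) u.
Proof.
move=> /VV_chain [ws [uniq_ws size_ws ws_phi _]].
by have := uniq_leq_size uniq_ws ws_phi; rewrite /= size_ws ltnn.
Qed.

Lemma MM_notin_VV n v :
  ~ V n v -> MMn n v = if n is n'.+1 then MMn n' v else M v.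
Proof. by case: n => [|n] /=; case: excluded_middle_informative. Qed.

Definition added n v e :=
  (V 0 v /\ eqV e s) \/
  exists j u, [/\ j < n, V j u, memV (M u) (M v) & eqV e (MMn j u)].

Lemma added0 v e : added 0 v e <-> V 0 v /\ eqV e s.
Proof. by split=> [[//|[j [u []]]]|]; last left. Qed.

Lemma addedS n v e : added n.+1 v e <->
  added n v e \/ exists u, [/\ V n u, memV (M u) (M v) & eqV e (MMn n u)].
Proof.
split.
- case=> [|[j [u [+ Vu uv eu]]]]; first by left; left.
  rewrite ltnS leq_eqVlt => /predU1P [<-|lt_jn]; first by right; exists u.
  by left; right; exists j, u.
- case=> [[|[j [u [lt_jn Vu uv eu]]]]|[u [Vu uv eu]]]; first by left.
    by right; exists j, u; split=> //; apply: ltnW.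
  by right; exists n, u.
Qed.

Lemma memV_MM n v e : v \in Vars phi ->
  memV e (MMn n v) <-> memV e (M v) \/ added n v e.
Proof.
move=> v_phi; elim: n => [|n IH].
  rewrite added0 /=; case: excluded_middle_informative => V0v /=; last tauto.
  by rewrite memV_union2 memV_single; tauto.
rewrite addedS -or_assoc -IH /=.
case: excluded_middle_informative => /= [_|nVv].
  rewrite memV_union2; apply: or_iff_compat_l.
  split=> [[[u [Vu uv]] eu]|[u [Vu uv eu]]]; first by exists u.
  by exists (exist _ u (conj Vu uv)).
by split=> [|[//|[u [Vu uv _]]]]; [left | case: nVv; split=> //; exists u].
Qed.

Lemma memV_MM_M n v e : v \in Vars phi -> memV e (M v) -> memV e (MMn n v).
Proof. by move=> v_phi e_v; apply/(memV_MM _ _ v_phi); left. Qed.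

Lemma memV_MMS n v e : v \in Vars phi -> memV e (MMn n v) -> memV e (MMn n.+1 v).
Proof. by move=> v_phi; rewrite !memV_MM // addedS; tauto. Qed.

Lemma memV_MM_VV n u v : v \in Vars phi -> V n u -> memV (M u) (M v) ->
  memV (MMn n u) (MMn n.+1 v).
Proof.
move=> v_phi Vu uv; apply/(memV_MM _ _ v_phi); rewrite addedS.
by right; right; exists u; split=> //; apply: eqV_refl.
Qed.

Lemma memV_MM_or_VV x y : y \in Vars phi -> memV (M x) (M y) ->
  forall n, V n x \/ memV (MMn n x) (MMn n y).
Proof.
move=> y_phi xy; elim=> [|n IH].
  case: (excluded_middle_informative (V 0 x)) => [|nVx]; first by left.
  by right; rewrite MM_notin_VV //; apply: memV_MM_M.
case: (excluded_middle_informative (V n.+1 x)) => [|nVx]; first by left.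
right; rewrite MM_notin_VV //.
by case: IH => [Vx|/memV_MMS]; [apply: memV_MM_VV | apply].
Qed.

Hypothesis s_rank : rank_assign_lt phi M s.

Lemma rk_lt_s_M v e : v \in Vars phi -> memV e (M v) -> rk_lt e s.
Proof. by move=> v_phi /memV_rk_lt /rk_lt_trans; apply; apply: s_rank. Qed.

Lemma rk_lt_s_MM n u : V n u -> rk_lt s (MMn n u).
Proof.
elim: n u => [|n IH] u Vu.
  apply/memV_rk_lt/(memV_MM _ _ (VV_Vars Vu)).
  by right; left; split=> //; apply: eqV_refl.
have [u_phi [w [Vw wu]]] := Vu.
exact: rk_lt_trans (IH w Vw) (memV_rk_lt (memV_MM_VV u_phi Vw wu)).
Qed.

Lemma added_rk_ge n v e : added n v e -> rk_le s e.
Proof.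
case=> [[_ es]|[j [u [_ Vu _ eu]]]]; first exact/eqV_rk_le/eqV_sym.
exact: rk_le_trans (rk_lt_le (rk_lt_s_MM Vu)) (eqV_rk_le (eqV_sym eu)).
Qed.

Lemma memV_M_added n v w e : v \in Vars phi -> memV e (M v) -> ~ added n w e.
Proof. by move=> v_phi /(rk_lt_s_M v_phi) lt_es /added_rk_ge /rk_le_lt_asym; apply. Qed.

Lemma eqV_s_MM n u : V n u -> ~ eqV s (MMn n u).
Proof. by move=> Vu /eqV_sym /eqV_rk_le /rk_le_lt_asym; apply; apply: rk_lt_s_MM. Qed.

Lemma memV_MM_low n v e : v \in Vars phi -> rk_lt e s ->
  memV e (MMn n v) <-> memV e (M v).
Proof.
move=> v_phi lt_es; rewrite memV_MM //.
by split=> [[//|/added_rk_ge /rk_le_lt_asym /(_ lt_es) []]|]; left.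
Qed.

Lemma eqV_MM_M m n u v : u \in Vars phi -> v \in Vars phi ->
  eqV (MMn m u) (MMn n v) -> eqV (M u) (M v).
Proof.
move=> u_phi v_phi uv; apply: eqV_ext => e; split=> e_M.
- rewrite -(memV_MM_low n v_phi (rk_lt_s_M u_phi e_M)).
  exact/(memV_eqVr uv)/memV_MM_M.
- rewrite -(memV_MM_low m u_phi (rk_lt_s_M v_phi e_M)).
  exact/(memV_eqVr (eqV_sym uv))/memV_MM_M.
Qed.

Section SetdiffLiteral.
Variables (n x y z : nat).
Hypotheses (x_phi : x \in Vars phi) (y_phi : y \in Vars phi) (z_phi : z \in Vars phi).
Hypotheses (M_xyz : eqV (M x) (setdiff (M y) (M z)))
           (Mbar_xyz : eqV (Mbar x) (setdiff (Mbar y) (Mbar z))).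

Lemma added_setdiff e : added n x e <-> added n y e /\ ~ added n z e.
Proof.
have V0x : V 0 x <-> V 0 y /\ ~ V 0 z by rewrite /= (memV_eqV_setdiff _ Mbar_xyz); tauto.
have Mx u : memV (M u) (M x) <-> memV (M u) (M y) /\ ~ memV (M u) (M z).
  exact: memV_eqV_setdiff.
split.
- case=> [[/V0x [V0y nV0z] es]|[j [u [lt_jn Vu /Mx [uy nuz] eu]]]].
    split; first by left.
    case=> [[]//|[j [u [_ Vu _ eu]]]].
    exact: eqV_s_MM Vu (eqV_trans (eqV_sym es) eu).
  split; first by right; exists j, u.
  case=> [[_ es]|[j' [u' [_ Vu' u'z eu']]]].
    exact: eqV_s_MM Vu (eqV_trans (eqV_sym es) eu).
  apply: nuz; apply: memV_eqVl u'z.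
  exact: eqV_MM_M (VV_Vars Vu') (VV_Vars Vu) (eqV_trans (eqV_sym eu') eu).
- case=> [[[V0y es]|[j [u [lt_jn Vu uy eu]]]] nz].
    by left; split=> //; apply/V0x; split=> // V0z; apply: nz; left.
  right; exists j, u; split=> //; apply/Mx; split=> // uz.
  by apply: nz; right; exists j, u.
Qed.

Lemma MM_setdiff : eqV (MMn n x) (setdiff (MMn n y) (MMn n z)).
Proof.
apply: eqV_ext => e; rewrite memV_setdiff !memV_MM // added_setdiff.
rewrite (memV_eqV_setdiff _ M_xyz).
have := @memV_M_added n y z e y_phi; have := @memV_M_added n z y e z_phi.
tauto.
Qed.
End SetdiffLiteral.

Lemma MM_satisfies : satisfies M phi -> satisfies Mbar phi ->
  satisfies (MMn (size (Vars phi))) phi.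
Proof.
move=> M_phi Mbar_phi [x y|x y z] l_phi /=; have l_vars := lit_vars_Vars l_phi.
- have y_phi : y \in Vars phi by apply: l_vars; rewrite !inE eqxx orbT.
  by have [/VV_size_Vars|] := memV_MM_or_VV y_phi (M_phi _ l_phi) (size (Vars phi)).
- have [x_phi y_phi z_phi] : [/\ x \in Vars phi, y \in Vars phi & z \in Vars phi].
    by split; apply: l_vars; rewrite !inE eqxx ?orbT.
  exact: MM_setdiff _ x_phi y_phi z_phi (M_phi _ l_phi) (Mbar_phi _ l_phi).
Qed.
End Construction.

Unset Implicit Arguments.

Theorem lemma10 (phi : formula) (M Mbar : assignment) (xb yb : nat) (t s : Vset) :
  satisfies M phi ->
  xb \in Vars phi -> yb \in Vars phi ->
  satisfies Mbar phi ->
  ~ eqV (Mbar xb) (Mbar yb) ->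
  ((memV t (Mbar xb) /\ ~ memV t (Mbar yb)) \/ (memV t (Mbar yb) /\ ~ memV t (Mbar xb))) ->
  rank_assign_lt phi M s ->
  satisfies (MM phi M Mbar t s (size (Vars phi))) phi.
Proof. by move=> M_phi _ _ Mbar_phi _ _ s_rank; apply: MM_satisfies. Qed.
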